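(* Let $n\ge 2$ and $0\leq k\leq n-1$ be integers. The number of prime parking functions of length $n$ with exactly $k$ fixed points is $$\binom{n-1}{k}(n-2)^{n-k-1},$$ with the convention $0^0=1$.
   Context: A parking function of length $n$ is a sequence $\pi=(\pi_1,\dots,\pi_n)$ of positive integers such that, if $\lambda_1\le\cdots\le\lambda_n$ is the weakly increasing rearrangement of $\pi_1,\dots,\pi_n$, then $\lambda_i\le i$ for all $1\le i\le n$. A parking function $\pi$ of length $n$ is prime if for all $1\le j\le n-1$ one has $\#\{i: \pi_i\le j\}\ge j+1$. An index $i\in\{1,\dots,n\}$ is a fixed point of $\pi$ if $\pi_i=i$. *)

(* Defs.v *)
From mathcomp Require Import all_boot.

Set Implicit Arguments.
Unset Strict Implicit.
Unset Printing Implicit Defensive.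

(* A sequence pi_1, ..., pi_n is an n-tuple of nat, and pi_i is tnth pi (i - 1):
   the mathematical index of i : 'I_n is i.+1. *)

Definition is_parking (n : nat) (pi : n.-tuple nat) : bool :=
  [forall i : 'I_n, 0 < tnth pi i]
  && [forall i : 'I_n, nth 0 (sort leq pi) i <= i.+1].

(* j : 'I_n with 0 < j ranges over 1, ..., n - 1; here j is a value bound, not
   an index, so it is not shifted. *)
Definition is_prime_parking (n : nat) (pi : n.-tuple nat) : bool :=
  is_parking pi
  && [forall j : 'I_n, (0 < j) ==> (j + 1 <= #|[set i : 'I_n | tnth pi i <= j]|)].

Definition fixed_points (n : nat) (pi : n.-tuple nat) : {set 'I_n} :=
  [set i : 'I_n | tnth pi i == i.+1].

(* Main.v *)
(* Write n = p + 2. A prime parking function takes its values in {1, ..., n - 1},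
   which we identify with Z/(n - 1). Let s in Z/(n - 1) act on all functions
   pi : {1, ..., n} -> Z/(n - 1) by adding s to the values while rotating the
   positions 1, ..., n - 1 by s as well. Position n is never fixed by a prime
   parking function, so this preserves the number of fixed points; and by the
   cycle lemma each pi has exactly one prime translate. Hence the
   prime parking functions with k fixed points are 1/(n - 1) of the functions
   with k fixed points among 1, ..., n - 1, which number
   C(n - 1, k) (n - 2)^(n - 1 - k) (n - 1). *)
Require Import Defs.
From mathcomp Require Import all_boot ssralg zmodp.
From mathcomp Require Import zify.
From mathcomp Require Import classical_sets cardinality.

Set Implicit Arguments.
Unset Strict Implicit.
Unset Printing Implicit Defensive.

(* The walk is N t - t, which rises by 1 over a period m; the unique good start s
   is the last minimum of the walk on [0, m), found by minimizing key
   lexicographically. *)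
Lemma cycle_lemma (m : nat) (N : nat -> nat) :
  0 < m -> (forall t, N (t + m) = N t + m.+1) ->
  #|[pred s : 'I_m | [forall j : 'I_m, N s + j.+1 < N (s + j.+1)]]| = 1.
Proof.
case: m => // m _ Nper.
pose good (s : 'I_m.+1) := forall j, 0 < j <= m.+1 -> N s + j < N (s + j).
(* Two good starts would make the walk rise by at least 1 from [s] to [r] and again from [r] to
   [s + m.+1], but it rises by only 1 over a period. *)
have good_uniq (s r : 'I_m.+1) : good s -> good r -> s < r -> False.
  move=> sgood rgood lt_sr; have := ltn_ord r; have := Nper s.
  have := sgood (r - s); have := rgood (s + m.+1 - r).
  have -> : r + (s + m.+1 - r) = s + m.+1 by have := ltn_ord r; lia.
  by have -> : s + (r - s) = r; lia.
pose key (s : 'I_m.+1) := (N s + (m.+1 - s)) * m.+1 + (m - s).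
case: (@arg_minnP _ ord0 predT key isT) => s _ smin.
have ltkey (r : 'I_m.+1) :
    N s + r <= N r + s /\ (s < r -> N s + r < N r + s).
  have := smin r isT; rewrite /key; have := ltn_ord r; have := ltn_ord s.
  by nia.
(* Before the end of the window, strictness holds because [s] is the last minimum; past the end, the
   rise of 1 over a period makes the weak inequality strict. *)
have sgood : good s.
  move=> j lej; have := ltn_ord s; case: (ltnP (s + j) m.+1) => [lt_sj | ge_sj].
    by have [_] := ltkey (Ordinal lt_sj); rewrite /=; lia.
  have lt_sj : s + j - m.+1 < m.+1 by have := ltn_ord s; lia.
  have [] := ltkey (Ordinal lt_sj); have := Nper (s + j - m.+1).
  by rewrite subnK //=; lia.
apply: (@fintype.eq_card1 _ s) => r; rewrite !inE; apply/forallP/eqP => [rP | -> j].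
  have rgood : good r.
    by case=> [|j] //= lej; have /= := rP (Ordinal (lej : j < m.+1)).
  apply: val_inj; case: (ltngtP r s) => // [|] lt_rs.
  - by case: (good_uniq _ _ rgood sgood lt_rs).
  - by case: (good_uniq _ _ sgood rgood lt_rs).
by apply: sgood; rewrite /= ltn_ord.
Qed.

Lemma card_ltn_sum (I : finType) (h : I -> nat) (j : nat) :
  #|[pred i | h i < j]| = \sum_(v < j) #|[pred i | h i == v]|.
Proof.
elim: j => [|j IHj]; first by rewrite big_ord0; apply: fintype.eq_card0.
rewrite big_ord_recr /= -IHj -!sum1_card /=.
rewrite (bigID (fun i => h i < j)) /=.
by congr (_ + _); apply: eq_bigl => i; rewrite !inE; lia.
Qed.

(* The element v of 'I_p.+1 stands for the parking preference v + 1. *)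
Definition prime_fun (p : nat) (I : finType) (f : I -> 'I_p.+1) : bool :=
  [forall j : 'I_p.+1, j.+1 < #|[pred i | f i < j.+1]|].

Lemma prime_fun_bij (p : nat) (I J : finType) (h : J -> I)
    (f : I -> 'I_p.+1) (g : J -> 'I_p.+1) :
  bijective h -> g =1 f \o h -> prime_fun g = prime_fun f.
Proof.
move=> h_bij g_fh; apply: eq_forallb => j; congr (_ < _).
rewrite -!sum1_card (reindex h); last exact: onW_bij.
by apply: eq_bigl => i; rewrite !inE g_fh.
Qed.

(** This is the cycle lemma for the [N t] that counts, with period [p.+1], how often the residues of
    0, ..., t - 1 are taken: a good start [s] is a shift that makes [f] prime. One period adds
    [#|I|], which is one more than its length. *)
Lemma card_prime_shift (p : nat) (I : finType) (f : I -> 'I_p.+1) :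
  #|I| = p.+2 -> #|[pred s | prime_fun (fun i => (f i - s)%R)]| = 1.
Proof.
move=> cardI.
pose N t := \sum_(u < t) #|[pred i | f i == u %% p.+1 :> nat]|.
have ND t j : j <= p.+1 ->
    N (t + j) = N t + #|[pred i | (f i - inZp t)%R < j]|.
  move=> le_jp; rewrite /N big_split_ord card_ltn_sum; congr (_ + _).
  apply: eq_bigr => v _; apply: eq_card => i; rewrite !inE.
  have lt_vp : v < p.+1 by apply: leq_trans le_jp.
  rewrite -[v : nat]/(val (Ordinal lt_vp)) val_eqE GRing.subr_eq.
  by rewrite -val_eqE /= modnDmr addnC.
rewrite -[RHS](@cycle_lemma p.+1 N) // => [|t].
  apply: eq_card => s; rewrite !inE; apply: eq_forallb => j.
  by rewrite ND // ltn_add2l valZpK.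
rewrite ND //; congr (_ + _); rewrite -cardI.
by apply: eq_card => i; rewrite !inE ltn_ord.
Qed.

(* Some a is a position that can be fixed; None is the last position n. *)
Definition fixset (A : finType) (f : {ffun option A -> A}) : {set A} :=
  [set a | f (Some a) == a].

(** The value is forced on [F], has [#|A|.-1] choices at every other [Some a], and is free at
    [None]. *)
Lemma card_fixset_eq (A : finType) (F : {set A}) :
  #|[pred f | fixset f == F]| = #|A| * #|A|.-1 ^ (#|A| - #|F|).
Proof.
pose R o : pred A := if o is Some a
  then (if a \in F then pred1 a else predC1 a) else predT.
transitivity #|family R|.
  apply: eq_card => f; rewrite !inE; apply/eqP/familyP => [def_F [a|] | fR].
  - by rewrite /R -def_F !inE; case: ifP; rewrite !inE => // ->.
  - by rewrite inE.
  - apply/setP => a; have := fR (Some a); rewrite /R !inE.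
    by case: ifP => _; rewrite !inE => // /negbTE.
rewrite card_family foldrE big_image (bigD1 None) //=; congr (_ * _).
rewrite (reindex_omap Some id) => [|[]] //=.
rewrite (bigID (mem F)) /= big1 => [|a /andP[_ ->]]; last exact: card1.
have -> : #|A| - #|F| = #|~: F| by rewrite -(cardsC F) addKn.
rewrite mul1n -prod_nat_const.
apply: eq_big => [a | a /andP[_ /negbTE ->]]; first by rewrite inE eqxx.
exact: cardC1.
Qed.

Lemma card_fixset (A : finType) (k : nat) :
  #|[pred f : {ffun option A -> A} | #|fixset f| == k]|
  = 'C(#|A|, k) * (#|A| * #|A|.-1 ^ (#|A| - k)).
Proof.
rewrite -card_draws -[LHS]sum1_card -sum_nat_const.
rewrite (partition_big (@fixset A) (fun F => #|F| == k)) //.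
rewrite [RHS](eq_bigl (fun F : {set A} => #|F| == k)) => [|F];
  last by rewrite inE.
apply: eq_bigr => F /eqP <-; rewrite -card_fixset_eq -[RHS]sum1_card.
by apply: eq_bigl => f; rewrite !inE andbC; case: eqP => // ->; rewrite eqxx.
Qed.

(** Moving positions and values together turns a fixed point [a + s] of [f] into the fixed point
    [a]; [omap] leaves the last position in place. *)
Definition shift (p : nat) (s : 'I_p.+1) (f : {ffun option 'I_p.+1 -> 'I_p.+1}) :
    {ffun option 'I_p.+1 -> 'I_p.+1} :=
  [ffun o => (f (omap (fun a => a + s) o) - s)%R].

Lemma shift_inj (p : nat) (s : 'I_p.+1) : injective (shift s).
Proof.
apply: (can_inj (g := shift (- s)%R)) => f; apply/ffunP => o; rewrite !ffunE.
rewrite GRing.opprK GRing.subrK; congr (f _).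
by case: o => //= a; rewrite GRing.subrK.
Qed.

Lemma card_fixset_shift (p : nat) (s : 'I_p.+1) f :
  #|fixset (shift s f)| = #|fixset f|.
Proof.
rewrite -(card_preimset (fixset f) (GRing.addIr s)).
by apply: eq_card => a; rewrite !inE ffunE /= GRing.subr_eq.
Qed.

Lemma prime_fun_shift (p : nat) (s : 'I_p.+1) f :
  prime_fun (shift s f) = prime_fun (fun o => (f o - s)%R).
Proof.
apply: (@prime_fun_bij _ _ _ (omap (fun a => a + s)%R)) => [|o]; last by rewrite ffunE.
exists (omap (fun a => a - s)%R); apply: omapK => a.
- exact: GRing.addrK.
- exact: GRing.subrK.
Qed.

(** Double counting of the pairs [(s, f)] with [Q s f]: every [s] contributes the number sought, as
    [shift s] permutes the functions and keeps the number of fixed points, and every [f] with [k]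
    fixed points has exactly one [s]. *)
Lemma card_prime_fixset (p k : nat) :
  #|[pred f : {ffun option 'I_p.+1 -> 'I_p.+1}
      | prime_fun f && (#|fixset f| == k)]| = 'C(p.+1, k) * p ^ (p.+1 - k).
Proof.
apply/eqP; rewrite -(eqn_pmul2l (ltn0Sn p)); apply/eqP.
have := card_fixset 'I_p.+1 k; rewrite card_ord /= mulnCA => <-.
pose Q s f := prime_fun (@shift p s f) && (#|fixset f| == k).
transitivity (\sum_(s : 'I_p.+1) \sum_(f | Q s f) 1).
  rewrite -[X in X * _](card_ord p.+1) -sum_nat_const.
  apply: eq_bigr => s _; rewrite -[LHS]sum1_card (reindex_inj (@shift_inj p s)).
  by apply: eq_bigl => f; rewrite !inE card_fixset_shift.
rewrite (exchange_big_dep (fun f => #|fixset f| == k)) => [|s f _ /andP[]] //=.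
rewrite -[RHS]sum1_card; apply: eq_bigr => f fk.
rewrite -[RHS](@card_prime_shift p _ f).
  rewrite -[RHS]sum1_card; apply: eq_bigl => s.
  by rewrite !inE /Q fk andbT prime_fun_shift.
by rewrite card_option card_ord.
Qed.

(** If the sorted entry at [i] exceeded [j], so would all later ones, leaving at most [i] entries up
    to [j]. *)
Lemma nth_sort_leq (s : seq nat) (i j : nat) :
  i < count (fun x => x <= j) s -> nth 0 (sort leq s) i <= j.
Proof.
rewrite -(count_sort leq); move: (sort_sorted leq_total s).
move: (sort leq s) => t t_sorted lt_ic; rewrite leqNgt; apply/negP => lt_jt.
have := cat_take_drop i t => t_eq.
have : count (fun x => x <= j) (drop i t) = 0.
  apply/eqP; rewrite -leqn0 leqNgt -has_count -all_predC; apply/(all_nthP 0) => l.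
  rewrite size_drop => lt_l /=; rewrite nth_drop -ltnNge (leq_trans lt_jt) //.
  by apply: (sorted_leq_nth leq_trans leqnn); rewrite ?inE; lia.
move: lt_ic; rewrite -{1}t_eq count_cat => lt_ic count0.
have := count_size (fun x => x <= j) (take i t).
by move: lt_ic; rewrite count0 addn0 size_take_min; lia.
Qed.

Lemma card_tnth_count (n : nat) (T : Type) (t : n.-tuple T) (P : pred T) :
  #|[pred i | P (tnth t i)]| = count P t.
Proof. by rewrite -sum1_card -sum1_count big_tuple. Qed.

Lemma is_prime_parkingE (n : nat) (pi : n.-tuple nat) :
  1 < n ->
  is_prime_parking pi = [forall i, 0 < tnth pi i]
    && [forall j : 'I_n, (0 < j) ==> (j + 1 <= #|[set i : 'I_n | tnth pi i <= j]|)].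
Proof.
move=> n_gt1; rewrite /is_prime_parking /is_parking -andbA; congr (_ && _).
apply: andb_idl => /forallP prime_pi; apply/forallP => i; apply: nth_sort_leq.
rewrite -card_tnth_count.
(* Primality speaks only of bounds up to n - 1, so the last index uses n - 1 in place of n; this
   already counts all n entries. *)
have lt_j : minn i.+1 n.-1 < n by lia.
have := prime_pi (Ordinal lt_j); have -> /= : 0 < minn i.+1 n.-1 by lia.
rewrite cardsE; have := ltn_ord i => lt_in le_card.
apply: leq_trans (_ : minn i.+1 n.-1 + 1 <= _); first by lia.
apply: leq_trans le_card _; apply/subset_leq_card/fintype.subsetP => l; rewrite !inE; lia.
Qed.

Definition tuple_of_fun (p : nat) (f : {ffun option 'I_p.+1 -> 'I_p.+1}) :
    p.+2.-tuple nat :=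
  [tuple (f (unlift ord_max i)).+1 | i < p.+2].

Lemma unlift_bij (n : nat) (h : 'I_n.+1) : bijective (unlift h).
Proof.
exists (fun o => if o is Some j then lift h j else h) => [i | [j|]].
- by case: unliftP.
- by rewrite liftK.
- by rewrite unlift_none.
Qed.

Lemma tuple_of_fun_inj (p : nat) : injective (@tuple_of_fun p).
Proof.
move=> f g eq_fg; apply/ffunP => o; have [h _ hK] := unlift_bij (@ord_max p.+1).
have := congr1 (fun t => tnth t (h o)) eq_fg; rewrite !tnth_mktuple hK => -[].
exact: val_inj.
Qed.

Lemma card_fixed_points_tuple (p : nat) (f : {ffun option 'I_p.+1 -> 'I_p.+1}) :
  #|fixed_points (tuple_of_fun f)| = #|fixset f|.
Proof.
rewrite -(card_imset (fixset f) (@lift_inj p.+2 ord_max)); apply: eq_card => i.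
rewrite inE tnth_mktuple eqSS; case: (unliftP ord_max i) => [j -> | ->].
  by rewrite (mem_imset _ _ (@lift_inj _ _)) inE lift_max.
rewrite ltn_eqF //; apply/esym/finset.imsetP => -[j _ /eqP].
by rewrite (negbTE (neq_lift _ _)).
Qed.

Lemma prime_tuple_of_fun (p : nat) (f : {ffun option 'I_p.+1 -> 'I_p.+1}) :
  is_prime_parking (tuple_of_fun f) = prime_fun f.
Proof.
rewrite is_prime_parkingE //.
have -> : [forall i, 0 < tnth (tuple_of_fun f) i].
  by apply/forallP => i; rewrite tnth_mktuple.
rewrite -(prime_fun_bij (unlift_bij ord_max) (frefl _)) /=.
apply/forallP/forallP => [H j | H j].
  have := H (lift ord0 j); rewrite /= addn1 => /leq_trans -> //.
  by apply/subset_leq_card/fintype.subsetP => i; rewrite !inE tnth_mktuple.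
apply/implyP => j_gt0.
have lt_j : j.-1 < p.+1 by have := ltn_ord j; lia.
have := H (Ordinal lt_j); rewrite /= prednK // addn1 => /leq_trans -> //.
by apply/subset_leq_card/fintype.subsetP => i; rewrite !inE tnth_mktuple.
Qed.

Lemma tuple_of_fun_surj (p : nat) (pi : p.+2.-tuple nat) :
  is_prime_parking pi -> exists f, tuple_of_fun f = pi.
Proof.
rewrite is_prime_parkingE // => /andP[/forallP pi_gt0 /forallP pi_prime].
(* Primality at the bound n - 1 asks for n entries, hence all of them, so every value fits into
   ['I_p.+1] after subtracting 1. *)
have pi_le i : tnth pi i <= p.+1.
  have := pi_prime ord_max; rewrite /= addn1 -[X in X <= _](card_ord p.+2) => le_card.
  have /eqP/setP/(_ i) : [set i | tnth pi i <= p.+1] == [set: 'I_p.+2].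
    by rewrite eqEcard finset.subsetT cardsT.
  by rewrite !inE.
have [h hK _] := unlift_bij (@ord_max p.+1).
exists [ffun o => inord (tnth pi (h o)).-1]; apply: eq_from_tnth => i.
rewrite tnth_mktuple ffunE hK; have := pi_gt0 i; have := pi_le i => ? ?.
by rewrite inordK prednK.
Qed.

Local Open Scope classical_set_scope.
Local Open Scope card_scope.

Lemma card_eq_pred (T : finType) (P : pred T) : [set x | P x] #= `I_#|P|.
Proof.
rewrite (card_eqr card_II).
have -> : [set x | P x] = enum_val @` [set: 'I_#|P|].
  apply/seteqP; split => [x Px | _ [i _ <-]] /=; last exact: enum_valP.
  by exists (enum_rank_in Px x); rewrite // enum_rankK_in.
by apply: inj_card_eq => i j _ _; apply: enum_val_inj.
Qed.

Theorem theorem3p1 (n k : nat) (hn : 2 <= n) (hk : k <= n - 1) :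
  [set pi : n.-tuple nat | is_prime_parking pi /\ #|fixed_points pi| = k]
    #= `I_('C(n - 1, k) * (n - 2) ^ (n - k - 1)).
Proof.
case: n hn hk => [|[|p]] // _ _.
rewrite subnAC !subn1 subn2 /= -card_prime_fixset.
set P := [pred f | _].
have -> : [set pi : p.+2.-tuple nat | is_prime_parking pi /\ #|fixed_points pi| = k]
    = @tuple_of_fun p @` [set f | P f].
  apply/seteqP; split => [pi [pi_prime pi_k] | _ [f /andP[f_prime /eqP f_k] <-]] /=.
    have [f def_pi] := tuple_of_fun_surj pi_prime; exists f => //.
    by rewrite /= -prime_tuple_of_fun -card_fixed_points_tuple def_pi pi_prime pi_k /=.
  by rewrite prime_tuple_of_fun card_fixed_points_tuple.
apply: card_eq_trans (card_eq_pred P).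
by apply: inj_card_eq => f g _ _; apply: tuple_of_fun_inj.
Qed.
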